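(* Let $X,Y$ be real polynomials in two variables vanishing at the origin, and consider the polar equation $$\frac{dr}{d\theta}=\frac{R(r\cos\theta,r\sin\theta)}{T(r\cos\theta,r\sin\theta)}$$ of the system $\dot x=X(x,y)$, $\dot y=Y(x,y)$, where $R=(xX+yY)/r$ and $T=(xY-yX)/r^2$. Let $r=f(\sin\theta)+g(\sin\theta)\cos\theta$ be a star-like periodic orbit of this equation, where $f,g\in\mathcal{C}^\infty([-1,1])$. Then $\gamma(s)=\big(f(u(s)),g(u(s)),u(s)\big)$ is a heteroclinic solution of the three-dimensional polynomial differential system $$\begin{cases}\dfrac{df}{ds}=(1-u^2)(R_1T_0-R_0T_1),\\[2mm] \dfrac{dg}{ds}=-(1-u^2)T_1(R_1+ugT_1)+T_0(R_0+ugT_0),\\[2mm] \dfrac{du}{ds}=(1-u^2)\big(T_0^2-(1-u^2)T_1^2\big),\end{cases}$$ joining two critical points, each one of them in one of the two invariant planes $u=1$ and $u=-1$, where $T_i=T_i(f,g,u)$ and $R_i=R_i(f,g,u)$.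
   Context: A periodic orbit of $\dot x=X$, $\dot y=Y$ is star-like if it does not intersect $\{T=0\}$; it then corresponds to a smooth $2\pi$-periodic solution $r=F(\theta)>0$ of the polar equation. A function belongs to $\mathcal{C}^\infty([-1,1])$ if it is $\mathcal{C}^\infty$ in an open neighborhood of $[-1,1]$. Here $u(s)$ denotes the time parametrization of $u\in(-1,1)$ determined by the third equation along the curve, that is, a solution with values in $(-1,1)$ of $\frac{du}{ds}=(1-u^2)\big(T_0^2-(1-u^2)T_1^2\big)$ with $T_i$ evaluated at $(f(u),g(u),u)$. A heteroclinic solution joining two critical points is a solution defined for all $s\in\mathbb{R}$ that converges to one of these critical points as $s\to-\infty$ and to the other as $s\to+\infty$. Definition of $R_0,R_1,T_0,T_1$. Since $X,Y$ vanish at the origin, $R(r\cos\theta,r\sin\theta)=\cos\theta\,X(r\cos\theta,r\sin\theta)+\sin\theta\,Y(r\cos\theta,r\sin\theta)$ and $T(r\cos\theta,r\sin\theta)=\big(\cos\theta\,Y(r\cos\theta,r\sin\theta)-\sin\theta\,X(r\cos\theta,r\sin\theta)\big)/r$ are polynomials in $r,\cos\theta,\sin\theta$. Introduce variables $f,g,u,v$ with $v^2=1-u^2$, and substitute $\cos\theta=v$, $\sin\theta=u$, $r=f+vg$ (so $x=(f+vg)v$, $y=(f+vg)u$). Using $v^{2k}=(1-u^2)^k$ and $v^{2k+1}=v(1-u^2)^k$, the resulting expressions are written uniquely as $$R=R_0(f,g,u)+v\,R_1(f,g,u),\qquad T=T_0(f,g,u)+v\,T_1(f,g,u),$$ with $R_0,R_1,T_0,T_1$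 polynomials in $f,g,u$. *)

(* Defs.v *)
From HB Require Import structures.
From mathcomp Require Import all_boot all_order all_algebra.
From mathcomp Require mpoly.

Set Implicit Arguments.
Unset Strict Implicit.
Unset Printing Implicit Defensive.

Import Order.TTheory GRing.Theory Num.Theory.

Local Open Scope ring_scope.

(* [mpoly] is imported only inside this module: its notations clash with those
   of MathComp-Analysis. *)
Module PolarPoly.
Import mpoly.
Section PolarPoly.
Variable R : comNzRingType.

Definition eval2 (P : {mpoly R[2]}) (x y : R) : R := P.@[tnth [tuple x; y]].

Definition eval3 (P : {mpoly R[3]}) (a b c : R) : R :=
  P.@[tnth [tuple a; b; c]].

Section Polar.
(* In [polarR] and [polarT] the three variables stand for r, cos t, sin t. *)
Let r : {mpoly R[3]} := 'X_0.
Let c : {mpoly R[3]} := 'X_1.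
Let s : {mpoly R[3]} := 'X_2.

Definition polar (P : {mpoly R[2]}) : {mpoly R[3]} :=
  P \mPo [tuple r * c; r * s].

(* P(r c, r s) / r, for P without constant term. *)
Definition polar_div (P : {mpoly R[2]}) : {mpoly R[3]} :=
  \sum_(m <- msupp P) P@_m *: (r ^+ (mdeg m).-1 * c ^+ m 0 * s ^+ m 1).

Definition polarR (X Y : {mpoly R[2]}) : {mpoly R[3]} :=
  c * polar X + s * polar Y.

Definition polarT (X Y : {mpoly R[2]}) : {mpoly R[3]} :=
  c * polar_div Y - s * polar_div X.

Lemma polar_divE (P : {mpoly R[2]}) :
  eval2 P 0 0 = 0 -> r * polar_div P = polar P.
Proof.
move=> P0; rewrite /polar /polar_div comp_mpolyEX mulr_sumr !big_seq.
have mc0 : P@_0%MM = 0.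
  have prod0 (m : 'X_{1..2}) : \prod_(i < 2) tnth [tuple 0; 0] i ^+ m i = (m == 0%MM)%:R :> R.
    rewrite !big_ord_recl !big_ord0 !(tnth_nth 0) /= mulr1 -exprD expr0n.
    by rewrite -mdeg_eq0 mdegE !big_ord_recl big_ord0 addn0.
  rewrite -[RHS]P0 /eval2 mevalE; under eq_bigr do rewrite prod0.
  have [mP|mP] := boolP (0%MM \in msupp P).
    rewrite (bigD1_seq _ mP (msupp_uniq _)) /= eqxx mulr1 big1 ?addr0 // => m.
    by move=> /negPf ->; rewrite mulr0.
  rewrite (memN_msupp_eq0 mP) big_seq big1 // => m mmP.
  by rewrite (_ : m == 0%MM = false) ?mulr0 //; apply: contraNF mP => /eqP <-.
apply: eq_bigr => m mP; rewrite -scalerAr; congr (_ *: _).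
have m_gt0 : (0 < mdeg m)%N.
  rewrite lt0n mdeg_eq0; apply: contraL mP => /eqP ->.
  by rewrite mcoeff_msupp mc0 eqxx.
rewrite comp_mpolyX !mulrA -exprS prednK // mdegE !big_ord_recl !big_ord0.
rewrite addn0 mulr1 !(tnth_nth 0) /= !exprMn exprD.
rewrite (_ : lift ord0 ord0 = 1) //; last exact: val_inj.
by rewrite -!mulrA; congr (_ * _); rewrite mulrCA.
Qed.

Lemma eval3_polar (P : {mpoly R[2]}) (a b d : R) :
  eval3 (polar P) a b d = eval2 P (a * b) (a * d).
Proof.
rewrite /eval3 /polar /eval2 comp_mpolyEX raddf_sum /= mevalE.
apply: eq_bigr => m _; rewrite mevalZ comp_mpolyX rmorph_prod /=.
congr (_ * _); rewrite !big_ord_recl !big_ord0 !rmorphXn !(tnth_nth 0) /=.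
by rewrite !mevalM !mevalXU !(tnth_nth 0).
Qed.

Lemma eval3_polarR (X Y : {mpoly R[2]}) (a b d : R) :
  eval3 (polarR X Y) a b d =
  b * eval2 X (a * b) (a * d) + d * eval2 Y (a * b) (a * d).
Proof.
by rewrite -!eval3_polar /eval3 mevalD !mevalM !mevalXU !(tnth_nth 0).
Qed.

Lemma eval3_polarT (X Y : {mpoly R[2]}) (a b d : R) :
  eval2 X 0 0 = 0 -> eval2 Y 0 0 = 0 ->
  a * eval3 (polarT X Y) a b d =
  b * eval2 Y (a * b) (a * d) - d * eval2 X (a * b) (a * d).
Proof.
move=> /polar_divE X0 /polar_divE Y0; rewrite -!eval3_polar -X0 -Y0.
rewrite /eval3 mevalB !mevalM !mevalXU !(tnth_nth 0) /=.
by rewrite mulrBr [a * (b * _)]mulrCA [a * (d * _)]mulrCA.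
Qed.

End Polar.

Section Split.
(* The three variables now stand for f, g, u; the variable 'X of
   {poly {mpoly R[3]}} stands for v. *)
Let f : {mpoly R[3]} := 'X_0.
Let g : {mpoly R[3]} := 'X_1.
Let u : {mpoly R[3]} := 'X_2.

(* r := f + v g, cos t := v, sin t := u *)
Definition subst_fguv (P : {mpoly R[3]}) : {poly {mpoly R[3]}} :=
  mmap (fun a : R => (a%:MP)%:P) (tnth [tuple f%:P + 'X * g%:P; 'X; u%:P]) P.

(* Reducing with v ^ (2 k) = (1 - u ^ 2) ^ k and
   v ^ (2 k + 1) = v (1 - u ^ 2) ^ k. *)
Definition v_even (P : {poly {mpoly R[3]}}) : {mpoly R[3]} :=
  (even_poly P).[1 - u ^+ 2].
Definition v_odd (P : {poly {mpoly R[3]}}) : {mpoly R[3]} :=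
  (odd_poly P).[1 - u ^+ 2].

Lemma v_evenDodd (P : {mpoly R[3]}) (a b d w : R) : w ^+ 2 = 1 - d ^+ 2 ->
  eval3 P (a + w * b) w d =
  eval3 (v_even (subst_fguv P)) a b d + w * eval3 (v_odd (subst_fguv P)) a b d.
Proof.
move=> w2; pose e : {rmorphism {mpoly R[3]} -> R} := meval (tnth [tuple a; b; d]).
have eE q : eval3 q a b d = e q by [].
have eX : [/\ e f = a, e g = b & e u = d].
  by split; rewrite /= mevalXU (tnth_nth 0).
have [ef eg eu] := eX.
have eM q : e q.[1 - u ^+ 2] = (map_poly e (q \Po 'X^2)).[w].
  rewrite map_comp_poly map_polyXn horner_comp hornerXn w2 -eu.
  by rewrite -(rmorph1 e) -rmorphXn -rmorphB horner_map.
have eS q : e (v_even q) + w * e (v_odd q) = (map_poly e q).[w].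
  rewrite !eM -[in RHS](poly_even_odd q) rmorphD rmorphM /= map_polyX.
  by rewrite hornerD hornerMX [w * _]mulrC.
rewrite [in RHS]/eval3 eS /subst_fguv /mmap /eval3 mevalE.
rewrite raddf_sum horner_sum /=; apply: eq_bigr => m _.
rewrite rmorphM /= map_polyC hornerM hornerC /= mevalC; congr (_ * _).
rewrite /mmap1 !big_ord_recl !big_ord0 !mulr1 !(tnth_nth 0) /=.
rewrite !rmorphM !hornerM !rmorphXn /= !horner_exp.
rewrite rmorphD rmorphM /= !map_polyC map_polyX !hornerE /=.
by move: ef eg eu => /= -> -> ->.
Qed.

End Split.

Variables X Y : {mpoly R[2]}.
Definition R0 := v_even (subst_fguv (polarR X Y)).
Definition R1 := v_odd (subst_fguv (polarR X Y)).
Definition T0 := v_even (subst_fguv (polarT X Y)).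
Definition T1 := v_odd (subst_fguv (polarT X Y)).

End PolarPoly.
End PolarPoly.
Export PolarPoly.

From mathcomp Require Import all_classical all_reals all_analysis.
Import numFieldNormedType.Exports.
Local Open Scope classical_set_scope.

Section Analysis.
Variable R : realType.

Definition smooth_on (A : set R) (f : R -> R) :=
  forall n (x : R), A x -> derivable (f^`(n)) x 1.

Definition smooth_m1_1 (f : R -> R) :=
  exists U : set R, [/\ open U, `[(-1 : R), 1]%classic `<=` U & smooth_on U f].

Definition radius (x y : R) : R := Num.sqrt (x ^+ 2 + y ^+ 2).

Definition radialR (X Y : mpoly.mpoly 2 R) (x y : R) : R :=
  (x * eval2 X x y + y * eval2 Y x y) / radius x y.

Definition angularT (X Y : mpoly.mpoly 2 R) (x y : R) : R :=
  (x * eval2 Y x y - y * eval2 X x y) / radius x y ^+ 2.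

(* The periodic orbit is given as a periodic orbit r = F(t) of the polar
   equation dr/dt = R / T (t being the polar angle), i.e. as the closed curve
   (F(t) cos t, F(t) sin t), which must not meet {T = 0}. *)
Definition starlike_periodic_orbit (X Y : mpoly.mpoly 2 R) (F : R -> R) :=
  [/\ smooth_on [set: R] F,
      forall t, F (t + 2 * pi) = F t,
      forall t, 0 < F t,
      forall t, angularT X Y (F t * cos t) (F t * sin t) != 0
    & forall t : R, is_derive t 1 F
        (radialR X Y (F t * cos t) (F t * sin t) /
         angularT X Y (F t * cos t) (F t * sin t))].

Section Flow.
Variable V : R * R * R -> R * R * R.

Definition solution_on (J : set R) (c : R -> R * R * R) :=
  forall s : R, J s -> is_derive s 1 c (V (c s)).

Definition invariant_set (S : set (R * R * R)) :=
  forall (J : set R) (c : R -> R * R * R) (s0 s : R),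
    open J -> is_interval J -> solution_on J c ->
    J s0 -> J s -> S (c s0) -> S (c s).

Definition critical_point (p : R * R * R) := V p = 0.

Definition heteroclinic (c : R -> R * R * R) (p q : R * R * R) :=
  [/\ critical_point p /\ critical_point q, p != q, solution_on [set: R] c,
      c s @[s --> -oo] --> p & c s @[s --> +oo] --> q].
End Flow.

Definition system3 (X Y : mpoly.mpoly 2 R) (p : R * R * R) : R * R * R :=
  let: (f, g, u) := p in
  let R0 := eval3 (R0 X Y) f g u in let R1 := eval3 (R1 X Y) f g u in
  let T0 := eval3 (T0 X Y) f g u in let T1 := eval3 (T1 X Y) f g u in
  ((1 - u ^+ 2) * (R1 * T0 - R0 * T1),
   - ((1 - u ^+ 2) * T1 * (R1 + u * g * T1)) + T0 * (R0 + u * g * T0),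
   (1 - u ^+ 2) * (T0 ^+ 2 - (1 - u ^+ 2) * T1 ^+ 2)).

Definition plane_u (a : R) : set (R * R * R) := [set p | p.2 = a].

(* u parametrizes the curve (f, g, id) over ]-1, 1[ by the time s of system3. *)
Definition time_param (X Y : mpoly.mpoly 2 R) (f g u : R -> R) :=
  forall s : R, -1 < u s < 1 /\
    is_derive s 1 u (system3 X Y (f (u s), g (u s), u s)).2.

End Analysis.

(* Main.v *)
Require Import Defs.
From mathcomp Require Import all_boot all_order all_algebra.
From mathcomp Require mpoly.
From mathcomp Require Import all_classical all_reals all_analysis.
From mathcomp Require Import ring lra.
Set Implicit Arguments.
Unset Strict Implicit.
Unset Printing Implicit Defensive.
Import Order.TTheory GRing.Theory Num.Theory.
Import numFieldNormedType.Exports.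
Local Open Scope ring_scope.
Local Open Scope classical_set_scope.

(** On the unit circle write u for the sine and v for the cosine of an angle.
    Along the orbit r = f(u) + v g(u), so the polar equation reads
      f' v + g' v^2 - u g = (R0 + v R1) / (T0 + v T1),    v^2 = 1 - u^2,
    all functions being taken at (f(u), g(u), u).  Both (u, v) and (u, -v) lie
    on the circle; the half-difference and the half-sum of the two equations
    ([conjugate_slopes]) separate f' from g':
      f' D = R1 T0 - R0 T1,
      ((1 - u^2) g' - u g) D = R0 T0 - (1 - u^2) R1 T1,
    where D = T0^2 - (1 - u^2) T1^2 = (T0 + v T1) (T0 - v T1) is the function
    [speed].  Multiplied by 1 - u^2, respectively rearranged, these identities
    say that the curve (f(u), g(u), u) is tangent to the polynomial vector
    field, and that it is followed with du/ds = (1 - u^2) D(u)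
    ([time_param_solution]).

    The two factors of D are values of T at two points of the orbit.  As T does
    not vanish on this connected curve, they have the same sign, so D > 0 on
    [-1, 1] ([speed_gt0]), and by compactness 0 < m <= D <= M.  Hence
    du/ds = (1 - u^2) D(u) compares with the logistic equation: in the
    coordinate w with u = (e^w - 1) / (e^w + 1) it becomes w' = 2 D(u(w)), whose
    right-hand side is bounded away from 0 and infinity, so that it has
    solutions on the whole line ([autonomous_ode_solution]), and every solution
    in ]-1, 1[ increases from -1 to 1 ([logistic_cvg1]).  The limits
    (f(-1), g(-1), -1) and (f(1), g(1), 1) are critical points because, at
    v = 0, the polar equation says R0 + u g T0 = 0 ([endpoint_critical]).

    A plane u = a with a^2 = 1 is invariant because along a solution u - a
    solves a linear homogeneous equation ([linear_ode_eq0]). *)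

(** * Scalar differential equations *)

Lemma is_derive_continuous (R : realType) (F : R -> R) (x d : R) :
  is_derive x 1 F d -> {for x, continuous F}.
Proof. by move=> dF; apply/differentiable_continuous/derivable1_diffP. Qed.

Lemma mean_value_ge (R : realType) (F dF : R -> R) (m a b : R) : a <= b ->
  (forall x, a <= x <= b -> is_derive x 1 F (dF x)) ->
  (forall x, a <= x <= b -> m <= dF x) -> m * (b - a) <= F b - F a.
Proof.
move=> ab FdF mdF.
have [x||c] := @MVT_segment _ F dF _ _ ab.
- by rewrite in_itv /= => /andP[ax xb]; apply: FdF; rewrite !ltW.
- apply/continuous_in_subspaceT => x; rewrite inE /= in_itv /= => xab.
  exact: is_derive_continuous (FdF x xab).
rewrite in_itv /= => /mdF mc ->.
by rewrite ler_wpM2r ?subr_ge0.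
Qed.

Lemma mean_value_le (R : realType) (F dF : R -> R) (m a b : R) : a <= b ->
  (forall x, a <= x <= b -> is_derive x 1 F (dF x)) ->
  (forall x, a <= x <= b -> dF x <= m) -> F b - F a <= m * (b - a).
Proof.
move=> ab FdF mdF; rewrite -lerN2 -mulNr opprB.
have -> : F a - F b = (- F) b - (- F) a by rewrite /= opprK addrC.
apply: (@mean_value_ge _ (- F) (fun x => - dF x)) => // x xab.
  exact: is_deriveN (FdF x xab).
by rewrite lerN2 mdF.
Qed.

(** With h <= M, the derivative 2 (h - M) w^2 e^(-2 M x) of
    w^2 e^(-2 M x) is nonpositive: this nonnegative function, zero at a, stays
    zero. *)
Lemma linear_ode_eq0_right (R : realType) (h w : R -> R) (a b : R) : a <= b ->
  (forall x, a <= x <= b -> {for x, continuous h}) ->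
  (forall x, a <= x <= b -> is_derive x 1 w (h x * w x)) ->
  w a = 0 -> w b = 0.
Proof.
move=> ab ch dw wa.
have [|c _ hM] := @EVT_max _ h _ _ ab.
  apply/continuous_in_subspaceT => x; rewrite inE /= in_itv /=; exact: ch.
pose e : R -> R := (- (2 * h c)) \*: (@id R).
pose G : R -> R := (w ^+ 2) * (expR \o e).
have GE x : G x = w x ^+ 2 * expR (e x) by rewrite /G !fctE.
have dG x : a <= x <= b ->
    is_derive x 1 G (2 * (h x - h c) * w x ^+ 2 * expR (e x)).
  move=> /dw dwx.
  have de : is_derive x 1 e (- (2 * h c)).
    by apply: is_derive_eq; rewrite /GRing.scale /= mulr1.
  apply: is_derive_eq.
  by rewrite /GRing.scale /= !fctE expr1; ring.
have : G b - G a <= 0 * (b - a).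
  apply: (mean_value_le ab dG) => x xab; rewrite -mulrA.
  rewrite mulr_le0_ge0 ?(mulr_ge0 (sqr_ge0 _)) ?expR_ge0//.
  by rewrite mulr_ge0_le0// subr_le0 hM // in_itv.
rewrite mul0r !GE wa expr0n /= mul0r subr0 => w0.
have /eqP : w b ^+ 2 = 0.
  apply/eqP; rewrite eq_le sqr_ge0 andbT.
  by move: w0; rewrite pmulr_lle0 ?expR_gt0.
by rewrite sqrf_eq0 => /eqP.
Qed.

(** Time reversal reduces the case b < a to the previous one. *)
Lemma linear_ode_eq0 (R : realType) (h w : R -> R) (a b : R) :
  (forall x, Num.min a b <= x <= Num.max a b -> {for x, continuous h}) ->
  (forall x, Num.min a b <= x <= Num.max a b -> is_derive x 1 w (h x * w x)) ->
  w a = 0 -> w b = 0.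
Proof.
have [ab|/ltW ba] := leP a b; first exact: linear_ode_eq0_right.
move=> ch dw wa; rewrite -[b]opprK.
have inN x : - a <= x <= - b -> b <= - x <= a by rewrite lerNr lerNl andbC.
apply: (@linear_ode_eq0_right _ (fun x => - h (- x)) (w \o -%R) (- a) (- b)).
- by rewrite lerN2.
- move=> x /inN xab; apply: continuousN; apply: continuous_comp; last exact: ch.
  exact: opp_continuous.
- move=> x /inN/dw dwx; apply: is_derive_eq.
  by rewrite mulrN1 mulNr.
- by rewrite /= opprK.
Qed.

(** The value at x is the oriented integral from 0 to x.  On a
    neighbourhood of x it differs by a constant from the integral from a point
    a below 0 and x, to which the fundamental theorem of calculus applies. *)
Lemma continuous_primitive (R : realType) (h : R -> R) : continuous h ->
  exists H : R -> R, forall x : R, is_derive x 1 H (h x).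
Proof.
move=> ch; pose mu := @lebesgue_measure R.
pose I (a b : R) := (\int[mu]_(x in `[a, b]) h x)%R.
exists (fun x => I 0 x - I x 0) => x.
have hi a b : mu.-integrable `[a, b] (EFin \o h).
  apply: continuous_compact_integrable; first exact: segment_compact.
  exact: continuous_subspaceT.
have split a b c : a <= b -> b <= c -> I a c - I a b = I b c.
  move=> ab bc; rewrite /I Rintegral_itvB ?bnd_simp// Rintegral_itv_obnd_cbnd//.
  apply: integrableS (hi b c) => //; exact: subset_itv_oc_cc.
have rev a b : a <= b -> I b a = 0.
  rewrite le_eqVlt => /predU1P[->|ab]; rewrite /I.
    by rewrite set_itv1 Rintegral_set1.
  by rewrite set_itv_ge ?Rintegral_set0// bnd_simp -ltNge.
(* A common left endpoint for the integrals up to x and up to 0. *)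
pose a := Num.min 0 x - 1.
have a0 : a <= 0.
  by rewrite (@le_trans _ _ (Num.min 0 x))// ?ge_min ?lexx// lerBlDr lerDl.
have ax : a < x by rewrite ltrBlDr (@le_lt_trans _ _ x) ?ge_min ?lexx ?orbT// ltrDl.
have HE y : a <= y -> I a y - I a 0 = I 0 y - I y 0.
  move=> ay; have [y0|/ltW y0] := leP 0 y.
    by rewrite split // (rev 0 y y0) subr0.
  by rewrite (rev y 0) // sub0r -opprB split.
apply: (@near_eq_is_derive _ _ _ (fun y => I a y - I a 0)).
  by near=> y; apply: HE; apply: ltW; near: y; exact: lt_nbhsr.
have [|dF F'] := @continuous_FTC1_closed R h a x (x + 1) _ (hi _ _) ax (ch x).
  by rewrite ltrDl.
have dI : is_derive x 1 (I a) (h x) by split=> //; rewrite -derive1E.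
by have := is_deriveB dI (is_derive_cst (I a 0) x 1); rewrite subr0.
Unshelve. all: by end_near. Qed.

(** Separation of variables: w is the inverse of a primitive of 1 / k.  As
    1 / k >= 1 / M > 0 the primitive is a bijection of the line, and its
    inverse is therefore defined for all times; as k >= m > 0 has no zeros,
    1 / k is continuous. *)
Lemma autonomous_ode_solution (R : realType) (k : R -> R) (m M : R) :
  continuous k -> 0 < m -> (forall x, m <= k x <= M) ->
  forall w0 : R, exists w : R -> R,
    w 0 = w0 /\ forall s : R, is_derive s 1 w (k (w s)).
Proof.
move=> ck m0 kmM w0.
have k0 x : 0 < k x by have /andP[+ _] := kmM x; exact: lt_le_trans.
have M0 : 0 < M by have /andP[_] := kmM 0; exact: lt_le_trans.
have [|H dH] := @continuous_primitive R (fun x => (k x)^-1).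
  by move=> x; apply: continuousV; [rewrite gt_eqF|exact: ck].
have Hincr x y : x <= y -> M^-1 * (y - x) <= H y - H x.
  move=> xy; apply: (mean_value_ge xy (fun z _ => dH z)) => z _.
  by rewrite lef_pV2 ?posrE//; have /andP[] := kmM z.
have Hinj : injective H.
  move=> x y; wlog xy : x y / x <= y.
    by move=> W; case: (leP x y) => [/W //|/ltW/W yx /esym/yx].
  move=> Hxy; have := Hincr _ _ xy; rewrite Hxy subrr pmulr_rle0 ?invr_gt0//.
  by rewrite subr_le0 => yx; apply/eqP; rewrite eq_le xy yx.
have cH : continuous H by move=> x; exact: is_derive_continuous (dH x).
have Hsurj s : exists x, H x = H w0 + s.
  (* H grows at rate at least 1 / M, so it gains |s| over a length M |s|. *)
  pose d := M * `|s|.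
  have d0 : 0 <= d by rewrite mulr_ge0// ltW.
  have Md : M^-1 * d = `|s| by rewrite /d mulrA mulVf ?mul1r// gt_eqF.
  have lo : H (w0 - d) <= H w0 - `|s|.
    have := Hincr (w0 - d) w0; rewrite subKr Md gerBl => /(_ d0); lra.
  have hi : H w0 + `|s| <= H (w0 + d).
    have := Hincr w0 (w0 + d); rewrite addrAC subrr add0r Md lerDl => /(_ d0); lra.
  have shi := ler_norm s; have slo := lerNnormlW (lexx `|s|).
  have [|||x _ xs] := @IVT R H (w0 - d) (w0 + d) (H w0 + s).
  - lra.
  - exact: continuous_subspaceT.
  - by rewrite ge_min le_max; apply/andP; split; apply/orP; [left|right]; lra.
  - by exists x.
have [w Hw] := choice Hsurj.
exists w; split; first by apply: Hinj; rewrite Hw addr0.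
move=> s; pose G x := H x - H w0.
have wG : cancel G w by move=> x; apply: Hinj; rewrite Hw addrC subrK.
have Gw : G (w s) = s by rewrite /G Hw addrC addKr.
have dG (x : R) : is_derive x 1 G (k x)^-1.
  by have := is_deriveB (dH x) (is_derive_cst (H w0) x 1); rewrite subr0.
have := @is_derive_inverse R G w (k (w s))^-1 (w s).
rewrite Gw invrK; apply.
- by near=> x; exact: wG.
- by near=> x; exact: is_derive_continuous (dG x).
- by rewrite invr_eq0 gt_eqF.
Unshelve. all: by end_near. Qed.

(** * Vector-valued derivatives and continuity of polynomials *)

Section ProductDerivative.
Variables (R : realType) (V W : normedModType R).

Lemma is_derive_cvgP (U : normedModType R) (c : R -> U) (s : R) (d : U) :
  is_derive s 1 c d <-> h^-1 *: (c (h + s) - c s) @[h --> 0^'] --> d.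
Proof.
have E : (fun h : R => h^-1 *: ((c \o shift s) (h *: 1) - c s)) =
    (fun h => h^-1 *: (c (h + s) - c s)).
  by apply/funext => h; rewrite /= /GRing.scale /= mulr1.
split=> [[dc <-]|cd].
  by move: dc; rewrite /derive /derivable E.
by split; [rewrite /derivable E; exact/cvgP/cd|rewrite /derive E; exact/cvg_lim].
Qed.

Lemma is_derive_pair (a : R -> V) (b : R -> W) (s : R) (da : V) (db : W) :
  is_derive s 1 a da -> is_derive s 1 b db ->
  is_derive s 1 (fun x => (a x, b x)) (da, db).
Proof.
move=> /is_derive_cvgP da' /is_derive_cvgP db'; apply/is_derive_cvgP.
exact: cvg_pair.
Qed.

Lemma is_derive_fst (c : R -> V * W) (s : R) (d : V * W) :
  is_derive s 1 c d -> is_derive s 1 (fun x => (c x).1) d.1.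
Proof.
move=> /is_derive_cvgP dc; apply/is_derive_cvgP.
exact: (cvg_comp _ _ dc (@cvg_fst _ _ _ _ _)).
Qed.

Lemma is_derive_snd (c : R -> V * W) (s : R) (d : V * W) :
  is_derive s 1 c d -> is_derive s 1 (fun x => (c x).2) d.2.
Proof.
move=> /is_derive_cvgP dc; apply/is_derive_cvgP.
exact: (cvg_comp _ _ dc (@cvg_snd _ _ _ _ _)).
Qed.
End ProductDerivative.

(** Stated for an arbitrary filter, because it serves both along the curve
    u |-> (f u, g u, u) and along an arbitrary solution of the system. *)
Lemma cvg_eval3 (R : realType) (T : Type) (F : set_system T)
    (P : mpoly.mpoly 3 R) (a b c : T -> R) (la lb lc : R) : Filter F ->
  a x @[x --> F] --> la -> b x @[x --> F] --> lb -> c x @[x --> F] --> lc ->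
  eval3 P (a x) (b x) (c x) @[x --> F] --> eval3 P la lb lc.
Proof.
move=> FF ca cb cc; rewrite /eval3 mpoly.mevalE.
under eq_fun do rewrite mpoly.mevalE.
apply: cvg_big => [|m _]; first exact: add_continuous.
apply: cvgM; first exact: cvg_cst.
apply: cvg_big => [|i _]; first exact: mul_continuous.
have ct : tnth [tuple a x; b x; c x] i @[x --> F] --> tnth [tuple la; lb; lc] i.
  by case: i => -[ilt|[ilt|[ilt|//]]]; [exact: ca|exact: cb|exact: cc].
exact: (cvg_comp _ _ ct (@exprn_continuous _ _ _)).
Qed.

(** * The logistic coordinate *)

(** The bijection of the line onto ]-1, 1[ that solves u' = (1 - u^2) / 2.
    It is the hyperbolic tangent of w / 2. *)
Definition logistic (R : realType) (w : R) : R := 1 - 2 / (1 + expR w).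

Lemma logistic_itv (R : realType) (w : R) : -1 < logistic w < 1.
Proof.
have e0 := expR_gt0 w; have e1 : 0 < 1 + expR w by lra.
rewrite /logistic; have : 0 < 2 / (1 + expR w) < 2.
  by rewrite divr_gt0//= ltr_pdivrMr//; lra.
by move=> /andP[? ?]; apply/andP; split; lra.
Qed.

Lemma is_derive_logistic (R : realType) (w : R) :
  is_derive w 1 (@logistic R) ((1 - logistic w ^+ 2) / 2).
Proof.
have e0 := expR_gt0 w; have e1 : 1 + expR w != 0 by rewrite gt_eqF//; lra.
have dE : is_derive w 1 (cst 1 + expR) (0 + expR w).
  exact: is_deriveD.
have dV := @is_deriveV _ (cst 1 + expR) w _ _ e1 dE.
have := is_deriveB (is_derive_cst (1 : R) w 1) (is_deriveZ 2 dV).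
by move=> /is_derive_eq; apply; rewrite /logistic /GRing.scale /= !fctE; field.
Qed.

(** The solution u is nondecreasing.  If it stayed below 1 - e, its
    derivative would be at least e (1 + u 0) m > 0 at all positive times, and u
    would leave ]-1, 1[. *)
Lemma logistic_cvg1 (R : realType) (D u : R -> R) (m : R) : 0 < m ->
  (forall x, -1 < x < 1 -> m <= D x) ->
  (forall s : R, -1 < u s < 1 /\ is_derive s 1 u ((1 - u s ^+ 2) * D (u s))) ->
  u s @[s --> +oo] --> (1 : R).
Proof.
move=> m0 mD u_sol.
have ui s : -1 < u s < 1 by case: (u_sol s).
have du (s : R) : is_derive s 1 u ((1 - u s ^+ 2) * D (u s)) by case: (u_sol s).
have u_le a b : a <= b -> u a <= u b.
  move=> ab; rewrite -subr_ge0 -[0](mul0r (b - a)).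
  apply: (mean_value_ge ab (fun s _ => du s)) => s _.
  have /andP[uN1 u1] := ui s; have mDs := mD _ (ui s).
  by rewrite mulr_ge0//; [nra|exact: le_trans (ltW m0) mDs].
apply/cvgrPdist_le => e e0; have [s1 us1] : exists s1, 1 - e <= u s1.
  apply: contrapT => /forallNP ue; have /andP[u0 _] := ui 0.
  (* At rate c, u would grow by 2, the length of ]-1, 1[, in time 2 / c. *)
  pose c := e * (1 + u 0) * m.
  have c0 : 0 < c by rewrite !mulr_gt0//; lra.
  have s0 : 0 <= 2 / c by rewrite divr_ge0 ?ltW.
  have : c * (2 / c - 0) <= u (2 / c) - u 0.
    apply: (mean_value_ge s0 (fun s _ => du s)) => s /andP[/u_le u0s _].
    have /andP[uN1 _] := ui s; have mDs := mD _ (ui s).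
    have /negP := ue s; rewrite -ltNge => us1.
    have -> : 1 - u s ^+ 2 = (1 - u s) * (1 + u s) by ring.
    by rewrite !ler_pM ?mulr_ge0//; lra.
  rewrite subr0 mulrC divfK ?gt_eqF//; have /andP[] := ui (2 / c); lra.
near=> s; have s1s : s1 <= s by near: s; apply: nbhs_pinfty_ge; rewrite num_real.
have := u_le _ _ s1s; have /andP[uN1 u1] := ui s => us1s.
by rewrite ger0_norm; lra.
Unshelve. all: by end_near. Qed.

(** * Connectedness and the unit circle *)

Lemma nonvanishing_mul_gt0 (R : realType) (F : R -> R) : continuous F ->
  (forall t, F t != 0) -> forall a b, 0 < F a * F b.
Proof.
move=> cF F0 a b; wlog ab : a b / a <= b.
  by move=> W; case: (leP a b) => [/W //|/ltW/W]; rewrite mulrC.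
rewrite lt_def mulf_neq0//=; apply: contraT; rewrite -ltNge => Fab.
have [||c _ /eqP] := @IVT R F a b 0 ab; last by rewrite (negPf (F0 c)).
  exact: continuous_subspaceT.
by rewrite ge_min le_max; have [?|?] := leP 0 (F a);
  have [?|?] := leP 0 (F b) => //=; nra.
Qed.

Lemma unit_circle_angle (R : realType) (u v : R) : v ^+ 2 = 1 - u ^+ 2 ->
  exists t, cos t = v /\ sin t = u.
Proof.
move=> uv.
have u1 : -1 <= u <= 1.
  by rewrite -ler_norml -(expr_le1 (n := 2))// real_normK ?num_real//
     -subr_ge0 -uv sqr_ge0.
have sv : Num.sqrt (1 - u ^+ 2) = `|v| by rewrite -uv sqrtr_sqr.
have [v0|v0] := leP 0 v.
  exists (asin u); rewrite cos_asin // asinK ?in_itv//.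
  by rewrite sv ger0_norm.
exists (pi - asin u); rewrite addrC cosDpi sinDpi cosN sinN opprK.
by rewrite cos_asin // asinK ?in_itv// sv ltr0_norm// opprK.
Qed.

Lemma subr1_sqr_ge0 (R : realType) (u : R) : -1 <= u <= 1 -> 0 <= 1 - u ^+ 2.
Proof. by move=> /andP[u1 u2]; nra. Qed.

(** * Algebra of the polar equation *)

(** The hypotheses are the polar equation at the two points (u, v) and
    (u, -v) of the circle, with a = f' and b = (1 - u^2) g' - u g.  Each is
    multiplied by the angular speed at the other point, and the two are then
    subtracted or added. *)
Lemma conjugate_slopes (R : realFieldType) (a b r0 r1 t0 t1 v : R) :
  (a * v + b) * (t0 + v * t1) = r0 + v * r1 ->
  (a * - v + b) * (t0 + - v * t1) = r0 + - v * r1 ->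
  v * (a * (t0 ^+ 2 - v ^+ 2 * t1 ^+ 2)) = v * (r1 * t0 - r0 * t1) /\
  b * (t0 ^+ 2 - v ^+ 2 * t1 ^+ 2) = r0 * t0 - v ^+ 2 * r1 * t1.
Proof.
move=> ep em; split.
  have -> : v * (a * (t0 ^+ 2 - v ^+ 2 * t1 ^+ 2)) =
    ((a * v + b) * (t0 + v * t1) * (t0 - v * t1) -
     (a * - v + b) * (t0 + - v * t1) * (t0 + v * t1)) / 2 by field.
  by rewrite ep em; field.
have -> : b * (t0 ^+ 2 - v ^+ 2 * t1 ^+ 2) =
    ((a * v + b) * (t0 + v * t1) * (t0 - v * t1) +
     (a * - v + b) * (t0 + - v * t1) * (t0 + v * t1)) / 2 by field.
by rewrite ep em; field.
Qed.

(** The second component of the vector field, recovered from the relation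
    for (1 - u^2) g' - u g.  It is stated for abstract ring elements to keep
    ring normalization away from evaluated polynomials, which it might
    unfold. *)
Lemma slope_to_field (R : comRingType) (g dg r0 r1 t0 t1 u : R) :
  (dg * (1 - u ^+ 2) - u * g) * (t0 ^+ 2 - (1 - u ^+ 2) * t1 ^+ 2) =
    r0 * t0 - (1 - u ^+ 2) * r1 * t1 ->
  dg * ((1 - u ^+ 2) * (t0 ^+ 2 - (1 - u ^+ 2) * t1 ^+ 2)) =
  - ((1 - u ^+ 2) * t1 * (r1 + u * g * t1)) + t0 * (r0 + u * g * t0).
Proof.
move=> slope.
have -> : dg * ((1 - u ^+ 2) * (t0 ^+ 2 - (1 - u ^+ 2) * t1 ^+ 2)) =
    (dg * (1 - u ^+ 2) - u * g) * (t0 ^+ 2 - (1 - u ^+ 2) * t1 ^+ 2) +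
    u * g * (t0 ^+ 2 - (1 - u ^+ 2) * t1 ^+ 2) by ring.
by rewrite slope; ring.
Qed.

(** The hypothesis is the polar equation at u = 1 or u = -1, where v = 0,
    and c stands for u g. *)
Lemma slope_to_zero (R : comRingType) (a b c r0 r1 t0 t1 s : R) :
  (a * 0 + (b * 0 - c)) * (t0 + 0 * t1) = r0 + 0 * r1 ->
  (0 * (r1 * t0 - r0 * t1), - (0 * t1 * (r1 + c * t1)) + t0 * (r0 + c * t0),
   0 * s) = (0, 0, 0) :> R * R * R.
Proof.
rewrite !mulr0 !mul0r !add0r !addr0 mulNr => <-.
by rewrite oppr0 add0r addNr mulr0.
Qed.

(** * The curve carried by a star-like orbit *)

Lemma radius_polar (R : realType) (r t : R) : 0 < r ->
  Defs.radius (r * cos t) (r * sin t) = r.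
Proof.
move=> r0; rewrite /Defs.radius !exprMn -mulrDr cos2Dsin2 mulr1 sqrtr_sqr.
by rewrite gtr0_norm.
Qed.

Lemma smooth_m1_1_derivable (R : realType) (f : R -> R) (x : R) :
  smooth_m1_1 f -> -1 <= x <= 1 -> derivable f x 1.
Proof.
by move=> [U [_ iU fU]] x1; apply: (fU 0%N); apply: iU; rewrite /= in_itv.
Qed.

Definition along (R : realType) (f g : R -> R) (P : mpoly.mpoly 3 R) (u : R) :=
  eval3 P (f u) (g u) u.

Section StarlikeOrbit.
Variables (R : realType) (X Y : mpoly.mpoly 2 R) (f g : R -> R).
Hypotheses (X0 : eval2 X 0 0 = 0) (Y0 : eval2 Y 0 0 = 0).
Hypotheses (f_smooth : smooth_m1_1 f) (g_smooth : smooth_m1_1 g).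
Hypothesis orbit :
  starlike_periodic_orbit X Y (fun t => f (sin t) + g (sin t) * cos t).

Local Notation r0 := (along f g (R0 X Y)).
Local Notation r1 := (along f g (R1 X Y)).
Local Notation t0 := (along f g (T0 X Y)).
Local Notation t1 := (along f g (T1 X Y)).

Lemma polar_split (P : mpoly.mpoly 3 R) (t : R) :
  eval3 P (f (sin t) + g (sin t) * cos t) (cos t) (sin t) =
  along f g (v_even (subst_fguv P)) (sin t) +
  cos t * along f g (v_odd (subst_fguv P)) (sin t).
Proof.
rewrite [g _ * _]mulrC v_evenDodd//.
by rewrite -(cos2Dsin2 t) addrK.
Qed.

Lemma angularTE (t : R) : let F t := f (sin t) + g (sin t) * cos t in
  angularT X Y (F t * cos t) (F t * sin t) = t0 (sin t) + cos t * t1 (sin t).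
Proof.
case: orbit => _ _ F0 _ _ F; have {F0}r_gt0 : 0 < F t := F0 t.
rewrite /angularT radius_polar// -[RHS]polar_split -/(F t).
move: (F t) r_gt0 => r r_gt0.
have /= E := eval3_polarT r (cos t) (sin t) X0 Y0.
rewrite -!mulrA -mulrBr -E expr2 invfM; field; exact: lt0r_neq0.
Qed.

Lemma radialRE (t : R) : let F t := f (sin t) + g (sin t) * cos t in
  radialR X Y (F t * cos t) (F t * sin t) = r0 (sin t) + cos t * r1 (sin t).
Proof.
case: orbit => _ _ F0 _ _ F; have {F0}r_gt0 : 0 < F t := F0 t.
rewrite /radialR radius_polar// -[RHS]polar_split -/(F t) eval3_polarR.
move: (F t) r_gt0 => r r_gt0.
field; exact: lt0r_neq0.
Qed.

Lemma angular_neq0 (t : R) : t0 (sin t) + cos t * t1 (sin t) != 0.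
Proof. by rewrite -angularTE; case: orbit. Qed.

Lemma sin_itv (t : R) : -1 <= sin t <= 1.
Proof. by rewrite sin_geN1 sin_le1. Qed.

Lemma is_derive_f (u : R) : -1 <= u <= 1 -> is_derive u 1 f (derive1 f u).
Proof.
move=> u1; rewrite derive1E; apply: derivableP.
exact: smooth_m1_1_derivable.
Qed.

Lemma is_derive_g (u : R) : -1 <= u <= 1 -> is_derive u 1 g (derive1 g u).
Proof.
move=> u1; rewrite derive1E; apply: derivableP.
exact: smooth_m1_1_derivable.
Qed.

(** The polar equation at a point of the unit circle.  Both signs of v
    occur, which makes the separation of f' and g' possible. *)
Lemma orbit_slope (u v : R) : v ^+ 2 = 1 - u ^+ 2 ->
  (derive1 f u * v + (derive1 g u * (1 - u ^+ 2) - u * g u)) *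
    (t0 u + v * t1 u) =
  r0 u + v * r1 u.
Proof.
move=> v2; rewrite -v2; have [t [<- <-]] := unit_circle_angle v2.
rewrite -[RHS](divfK (angular_neq0 t)); congr (_ * _).
case: orbit => _ _ _ _ /(_ t); rewrite angularTE radialRE => -[_ <-].
have dft := is_derive_f (sin_itv t); have dgt := is_derive_g (sin_itv t).
have dfs : is_derive t 1 (f \o sin) (derive1 f (sin t) * cos t).
  exact: is_derive1_comp.
have dgs : is_derive t 1 (g \o sin) (derive1 g (sin t) * cos t).
  exact: is_derive1_comp.
have [_ dF] := is_deriveD dfs (is_deriveM dgs (is_derive_cos t)).
by rewrite [RHS]dF /= /GRing.scale /=; ring.
Qed.

(** The factor D(u) of du/ds = (1 - u^2) D(u) along the curve; it is the
    product of the values of T at the two points of the orbit with sine u. *)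
Definition speed (u : R) := t0 u ^+ 2 - (1 - u ^+ 2) * t1 u ^+ 2.

Lemma along_cvg P (u : R) : -1 <= u <= 1 ->
  along f g P x @[x --> u] --> along f g P u.
Proof.
move=> u1; apply: cvg_eval3; last exact: cvg_id.
  exact: is_derive_continuous (is_derive_f u1).
exact: is_derive_continuous (is_derive_g u1).
Qed.

(** With u = sin t, the two factors T0 + v T1 and T0 - v T1 are the values
    of T at the angles t and pi - t. *)
Lemma speed_gt0 (u : R) : -1 <= u <= 1 -> 0 < speed u.
Proof.
move=> u1; pose F t := t0 (sin t) + cos t * t1 (sin t).
have cF : continuous F.
  move=> t; have along_sin P : {for t, continuous (along f g P \o sin)}.
    apply: continuous_comp; first exact: continuous_sin.
    exact: along_cvg (sin_itv t).
  apply: cvgD; first exact: along_sin.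
  by apply: cvgM; [exact: continuous_cos|exact: along_sin].
pose v := Num.sqrt (1 - u ^+ 2).
have v2 : v ^+ 2 = 1 - u ^+ 2 by rewrite sqr_sqrtr// subr1_sqr_ge0.
have [t [cost sint]] := unit_circle_angle v2.
have := nonvanishing_mul_gt0 cF angular_neq0 t (- t + pi).
rewrite /F sinDpi cosDpi sinN cosN opprK sint cost /speed -v2.
by congr (0 < _); ring.
Qed.

Lemma speed_cvg (u : R) : -1 <= u <= 1 -> speed x @[x --> u] --> speed u.
Proof.
move=> u1; have cT0 : t0 x @[x --> u] --> t0 u by exact: along_cvg.
have cT1 : t1 x @[x --> u] --> t1 u by exact: along_cvg.
have c2 : (x ^+ 2) @[x --> u] --> u ^+ 2 by exact: exprn_continuous.
apply: cvgB; first exact: (cvg_comp _ _ cT0 (@exprn_continuous _ 2 _)).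
apply: cvgM; last exact: (cvg_comp _ _ cT1 (@exprn_continuous _ 2 _)).
by apply: cvgB => //; exact: cvg_cst.
Qed.

Lemma speed_bounded : exists m M, 0 < m /\
  forall u : R, -1 <= u <= 1 -> m <= speed u <= M.
Proof.
have N11 : -1 <= 1 :> R by lra.
have cs : {within `[-1, 1], continuous speed}.
  apply/continuous_in_subspaceT => u; rewrite inE /= in_itv /=; exact: speed_cvg.
have [a a1 sa] := EVT_min N11 cs; have [b b1 sb] := EVT_max N11 cs.
exists (speed a), (speed b); split; first exact: speed_gt0.
by move=> u u1; rewrite sa ?sb// in_itv.
Qed.

(** The identity is obtained multiplied by v, whence the exclusion of
    u = 1 and u = -1, where v = 0. *)
Lemma orbit_df (u : R) : -1 < u < 1 ->
  derive1 f u * speed u = r1 u * t0 u - r0 u * t1 u.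
Proof.
move=> /andP[uN1 u1]; pose v := Num.sqrt (1 - u ^+ 2).
have v2 : v ^+ 2 = 1 - u ^+ 2 by rewrite sqr_sqrtr// subr1_sqr_ge0// !ltW.
have v0 : v != 0 by rewrite -sqrf_eq0 v2 gt_eqF//; nra.
apply: (mulfI v0); rewrite /speed.
have v2N : (- v) ^+ 2 = 1 - u ^+ 2 by rewrite sqrrN.
by have [] := conjugate_slopes (orbit_slope v2) (orbit_slope v2N); rewrite v2.
Qed.

Lemma orbit_dg (u : R) : -1 <= u <= 1 ->
  (derive1 g u * (1 - u ^+ 2) - u * g u) * speed u =
  r0 u * t0 u - (1 - u ^+ 2) * r1 u * t1 u.
Proof.
move=> u1; pose v := Num.sqrt (1 - u ^+ 2).
have v2 : v ^+ 2 = 1 - u ^+ 2 by rewrite sqr_sqrtr// subr1_sqr_ge0.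
have v2N : (- v) ^+ 2 = 1 - u ^+ 2 by rewrite sqrrN.
by have [_] := conjugate_slopes (orbit_slope v2) (orbit_slope v2N); rewrite v2.
Qed.
Lemma system3_along (u : R) :
  system3 X Y (f u, g u, u) =
  ((1 - u ^+ 2) * (r1 u * t0 u - r0 u * t1 u),
   - ((1 - u ^+ 2) * t1 u * (r1 u + u * g u * t1 u)) +
     t0 u * (r0 u + u * g u * t0 u),
   (1 - u ^+ 2) * speed u).
Proof. by []. Qed.

Lemma time_param_exists (u0 : R) : -1 < u0 < 1 ->
  exists u : R -> R, u 0 = u0 /\ time_param X Y f g u.
Proof.
move=> /andP[u0N1 u01]; have [m [M [m0 mM]]] := speed_bounded.
have [|||w [w0 dw]] := @autonomous_ode_solution _ (fun w => 2 * speed (logistic w))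
    (2 * m) (2 * M) _ _ _ (ln ((1 + u0) / (1 - u0))).
- move=> w; apply: cvgM; first exact: cvg_cst.
  apply: (@continuous_comp _ _ _ (@logistic R) speed).
    exact: is_derive_continuous (is_derive_logistic w).
  by apply: speed_cvg; have /andP[? ?] := logistic_itv w; rewrite !ltW.
- by rewrite mulr_gt0.
- move=> w; rewrite !ler_pM2l//; apply: mM.
  by have /andP[? ?] := logistic_itv w; rewrite !ltW.
exists (@logistic R \o w); split.
  rewrite /= w0 /logistic lnK; first by field; lra.
  by rewrite posrE divr_gt0//; lra.
move=> s; split; first exact: logistic_itv.
have := is_derive1_comp (is_derive_logistic (w s)) (dw s).
by move=> /is_derive_eq; apply; rewrite system3_along /=; field.
Qed.

Lemma time_param_cvgy (u : R -> R) : time_param X Y f g u ->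
  u s @[s --> +oo] --> (1 : R).
Proof.
move=> u_sol; have [m [M [m0 mM]]] := speed_bounded.
apply: (logistic_cvg1 (D := speed) m0) => [x /andP[? ?]|s]; last exact: u_sol.
by have /mM/andP[] : -1 <= x <= 1 by rewrite !ltW.
Qed.

(** The function s |-> - u (- s) solves an equation of the same kind, with
    D (- x) in the place of D (x), and thus tends to 1 at +oo. *)
Lemma time_param_cvgNy (u : R -> R) : time_param X Y f g u ->
  u s @[s --> -oo] --> (-1 : R).
Proof.
move=> u_sol; have [m [M [m0 mM]]] := speed_bounded.
apply/cvgNy_compNP; apply/cvgNP; rewrite opprK.
apply: (logistic_cvg1 (D := speed \o -%R) m0) => [x /andP[? ?]|s].
  by have /mM/andP[] : -1 <= - x <= 1 by apply/andP; split; lra.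
have [us du] := u_sol (- s).
split; first by rewrite /= ltrN2 ltrNl andbC.
have := is_deriveN (is_derive1_comp du (is_deriveNid s 1)).
move=> /is_derive_eq; apply; rewrite system3_along /= opprK sqrrN; ring.
Qed.

Lemma time_param_solution (u : R -> R) : time_param X Y f g u ->
  solution_on (system3 X Y) [set: R] (fun s => (f (u s), g (u s), u s)).
Proof.
move=> u_sol s _; have [us du] := u_sol s; have /andP[uN1 u1] := us.
have uc : -1 <= u s <= 1 by rewrite !ltW.
have dfu := is_derive1_comp (is_derive_f uc) du.
have dgu := is_derive1_comp (is_derive_g uc) du.
have := is_derive_pair (is_derive_pair dfu dgu) du.
move=> /is_derive_eq; apply; rewrite system3_along /=; congr (_, _, _).
  by rewrite -orbit_df//; ring.
exact: slope_to_field (orbit_dg uc).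
Qed.

Lemma endpoint_critical (u : R) : u ^+ 2 = 1 ->
  critical_point (system3 X Y) (f u, g u, u).
Proof.
move=> u2; have := @orbit_slope u 0; rewrite u2 subrr expr0n => /(_ erefl).
move=> slope; rewrite /critical_point system3_along u2 subrr.
exact: slope_to_zero slope.
Qed.

Lemma time_param_heteroclinic (u : R -> R) : time_param X Y f g u ->
  heteroclinic (system3 X Y) (fun s => (f (u s), g (u s), u s))
    (f (-1), g (-1), -1) (f 1, g 1, 1).
Proof.
move=> u_sol; split.
- by split; apply: endpoint_critical; rewrite ?sqrrN expr1n.
- by rewrite xpair_eqE negb_and; apply/orP; right; rewrite lt_eqF//; lra.
- exact: time_param_solution.
- have uy := time_param_cvgNy u_sol.
  have N1 : -1 <= (-1 : R) <= 1 by rewrite lexx /=; lra.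
  have cf := cvg_comp _ _ uy (is_derive_continuous (is_derive_f N1)).
  have cg := cvg_comp _ _ uy (is_derive_continuous (is_derive_g N1)).
  exact: (cvg_pair (cvg_pair cf cg) uy).
- have uy := time_param_cvgy u_sol.
  have N1 : -1 <= (1 : R) <= 1 by rewrite lexx andbT; lra.
  have cf := cvg_comp _ _ uy (is_derive_continuous (is_derive_f N1)).
  have cg := cvg_comp _ _ uy (is_derive_continuous (is_derive_g N1)).
  exact: (cvg_pair (cvg_pair cf cg) uy).
Qed.

End StarlikeOrbit.

(** * Invariant planes *)

(** Along a solution, (u - a)' = (1 - u^2) K = - (u + a) K (u - a), since
    a^2 = 1. *)
Lemma plane_invariant (R : realType) (X Y : mpoly.mpoly 2 R) (a : R) :
  a ^+ 2 = 1 -> invariant_set (system3 X Y) (plane_u a).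
Proof.
move=> a2 J c s0 s _ Jitv c_sol Js0 Js cs0.
pose K x := eval3 (T0 X Y) (c x).1.1 (c x).1.2 (c x).2 ^+ 2 -
  (1 - (c x).2 ^+ 2) * eval3 (T1 X Y) (c x).1.1 (c x).1.2 (c x).2 ^+ 2.
have Jx x : Num.min s0 s <= x <= Num.max s0 s -> J x.
  by rewrite /Num.min /Num.max; case: ifP => _; exact: Jitv.
have dc x : J x -> is_derive x 1 (fun y => (c y).2) ((1 - (c x).2 ^+ 2) * K x).
  move=> /c_sol/is_derive_snd/is_derive_eq; apply.
  by rewrite /K; case: (c x) => -[].
have cont x : J x -> {for x, continuous (fun y => - ((c y).2 + a) * K y)}.
  move=> Jx0; have c2 := is_derive_continuous (dc x Jx0).
  have c11 : {for x, continuous (fun y => (c y).1.1)}.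
    exact: is_derive_continuous (is_derive_fst (is_derive_fst (c_sol x Jx0))).
  have c12 : {for x, continuous (fun y => (c y).1.2)}.
    exact: is_derive_continuous (is_derive_snd (is_derive_fst (c_sol x Jx0))).
  have cP P := @cvg_eval3 _ _ _ P _ _ _ _ _ _ _ c11 c12 c2.
  have cX (k : R -> R) : {for x, continuous k} ->
      {for x, continuous (fun y => k y ^+ 2)}.
    by move=> ck; exact: (cvg_comp _ _ ck (@exprn_continuous _ 2 _)).
  apply: cvgM; first by apply: cvgN; apply: cvgD => //; exact: cvg_cst.
  apply: cvgB; first exact: cX (cP _ _).
  apply: cvgM; last exact: cX (cP _ _).
  by apply: cvgB; [exact: cvg_cst|exact: cX].
apply/eqP; rewrite -subr_eq0; apply/eqP.
apply: (@linear_ode_eq0 _ _ (fun y => (c y).2 - a) s0 s).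
- by move=> x /Jx; exact: cont.
- move=> x /Jx/dc dcx; have := is_deriveB dcx (is_derive_cst a x 1).
  by move=> /is_derive_eq; apply; rewrite -[X in (X - _) * _]a2; ring.
- by rewrite cs0 subrr.
Qed.

Theorem theorem2p7 (R : realType) (X Y : mpoly.mpoly 2 R) (f g : R -> R)
    (X0 : eval2 X 0 0 = 0) (Y0 : eval2 Y 0 0 = 0)
    (f_smooth : smooth_m1_1 f) (g_smooth : smooth_m1_1 g)
    (orbit : starlike_periodic_orbit X Y
       (fun t => f (sin t) + g (sin t) * cos t)) :
  [/\ invariant_set (system3 X Y) (plane_u 1),
      invariant_set (system3 X Y) (plane_u (-1)),
      forall u0 : R, -1 < u0 < 1 ->
        exists u : R -> R, u 0 = u0 /\ time_param X Y f g u
    & forall u : R -> R, time_param X Y f g u ->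
        exists p q : R * R * R,
          heteroclinic (system3 X Y) (fun s => (f (u s), g (u s), u s)) p q /\
          ((plane_u (-1) p /\ plane_u 1 q) \/ (plane_u 1 p /\ plane_u (-1) q))].
Proof.
split.
- by apply: plane_invariant; rewrite expr1n.
- by apply: plane_invariant; rewrite sqrrN expr1n.
- exact: time_param_exists X0 Y0 f_smooth g_smooth orbit.
- move=> u u_sol; exists (f (-1), g (-1), -1), (f 1, g 1, 1); split; last by left.
  exact: (time_param_heteroclinic X0 Y0 f_smooth g_smooth orbit u_sol).
Qed.
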